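(* Let $n$ be a positive integer and $p,q$ distinct prime numbers with $q<p$. Let $A_p$ be the trivial left brace of size $p$, let $A_q$ be a trivial left brace with cyclic multiplicative group of size $q^n$ (identified with the trivial left brace on $\mathbb{Z}/q^n\mathbb{Z}$), and let $\alpha:(A_q,\circ)\to\mathrm{Aut}(A_p,+)$ be a homomorphism such that the multiplicative group of the left brace semidirect product $A_p\rtimes_\alpha A_q$ is isomorphic to a group of type c). Let $(a_1,a_2),(b_1,b_2)\in A_p\rtimes_\alpha A_q$ be elements of two (not necessarily distinct) transitive cycle bases of $A_p\rtimes_\alpha A_q$, and let $(X_1,r_1)$ and $(X_2,r_2)$ be the indecomposable solutions constructed from $(a_1,a_2)$ and $(b_1,b_2)$ respectively, using the trivial subgroup. Then $(X_1,r_1)$ and $(X_2,r_2)$ are isomorphic if and only if $a_2\equiv b_2 \pmod q$.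
   Context: A solution is a pair $(X,r)$ with $X$ a non-empty set and $r:X\times X\to X\times X$, $r(x,y)=(\sigma_x(y),\tau_y(x))$, such that $(r\times \mathrm{id})(\mathrm{id}\times r)(r\times \mathrm{id})=(\mathrm{id}\times r)(r\times \mathrm{id})(\mathrm{id}\times r)$ on $X^3$, $r^2=\mathrm{id}$, and all maps $\sigma_x,\tau_y:X\to X$ are bijections. Two solutions $(X,r)$, $(X',r')$ are isomorphic if there is a bijection $f:X\to X'$ with $r'(f\times f)=(f\times f)r$. A solution is indecomposable if the subgroup of $\mathrm{Sym}(X)$ generated by all $\sigma_x$ acts transitively on $X$. A left brace is a set $B$ with two operations $+,\circ$ such that $(B,+)$ is an abelian group, $(B,\circ)$ is a group (the multiplicative group) and $a\circ(b+c)=a\circ b-a+a\circ c$ for all $a,b,c$. $B$ is trivial if $a\circ b=a+b$ for all $a,b$. Put $\lambda_a(b)=-a+a\circ b$; this defines an action of $(B,\circ)$ on $(B,+)$ by automorphisms. A transitive cycle base of $B$ is a subset which is a single orbit of the $\lambda$-action and generates $(B,+)$. The semidirect product $A_p\rtimes_\alpha A_q$ is the left brace on $A_p\times A_q$ with componentwise addition and $(x_1,x_2)\circ(y_1,y_2)=(x_1\circ\alpha_{x_2}(y_1),x_2\circ y_2)$. A group of type c) (for $p,q,n$) is a group $\langle a,b\mid a^p=b^{q^n}=1,\ b^{-1}ab=a^r\rangle$ where $p,q$ are distinct primes, $r\not\equiv 1\pmod p$, $r\equiv 1\pmod q$ and $r^q\equiv 1\pmod p$. Solution constructed from an element $a$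 of a transitive cycle base of a left brace $B$, using the trivial subgroup: underlying set $B$, $\sigma_x(y)=\lambda_x(a)\circ y$ and $\tau_y(x)=\sigma_{\sigma_x(y)}^{-1}(x)$ for all $x,y\in B$. *)

(* Defs.v *)
From HB Require Import structures.
From mathcomp Require Import all_boot all_order all_algebra all_fingroup.

Set Implicit Arguments.
Unset Strict Implicit.
Unset Printing Implicit Defensive.

Import GRing.Theory.
Local Open Scope ring_scope.

(* Set-theoretic solutions of the Yang-Baxter equation, with
   r (x, y) = (sigma_x y, tau_y x). *)

Definition map12 (X : Type) (r : X * X -> X * X) (t : X * X * X) : X * X * X :=
  let: (x, y, z) := t in let: (u, v) := r (x, y) in (u, v, z).

Definition map23 (X : Type) (r : X * X -> X * X) (t : X * X * X) : X * X * X :=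
  let: (x, y, z) := t in let: (v, w) := r (y, z) in (x, v, w).

Record solution := Solution {
  carrier :> Type;
  rmap : carrier * carrier -> carrier * carrier;
  carrier_inhabited : inhabited carrier;
  rmap_ybe : forall t,
    map12 rmap (map23 rmap (map12 rmap t)) =
    map23 rmap (map12 rmap (map23 rmap t));
  rmap_involutive : involutive rmap;
  sigma_bij : forall x, bijective (fun y => (rmap (x, y)).1);
  tau_bij : forall y, bijective (fun x => (rmap (x, y)).2)
}.

Definition sigma (S : solution) (x y : S) : S := (rmap (x, y)).1.

Definition isomorphic (S T : solution) : Prop :=
  exists f : S -> T, bijective f /\
    forall x y : S,
      rmap (f x, f y) = (f (rmap (x, y)).1, f (rmap (x, y)).2).

(* The subgroup of Sym(S) generated by the maps sigma_x. *)
Inductive perm_group (S : solution) : (S -> S) -> Prop :=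
| perm_group_id : perm_group id
| perm_group_sigma x : perm_group (@sigma S x)
| perm_group_comp g h : perm_group g -> perm_group h -> perm_group (g \o h)
| perm_group_inv g h :
    perm_group g -> cancel g h -> cancel h g -> perm_group h.

Definition indecomposable (S : solution) : Prop :=
  forall x y : S, exists2 g, perm_group g & g x = y.

HB.mixin Record isLeftBrace B of GRing.Zmodule B := {
  circ : B -> B -> B;
  cone : B;
  cinv : B -> B;
  circA : associative circ;
  circ1x : left_id cone circ;
  circVx : left_inverse cone cinv circ;
  circDr : forall a b c : B, circ a (b + c) = circ a b - a + circ a c
}.

#[short(type="leftBraceType")]
HB.structure Definition LeftBrace := {B of isLeftBrace B & GRing.Zmodule B}.

#[short(type="finLeftBraceType")]
HB.structure Definition FinLeftBrace := {B of LeftBrace B & Finite B}.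

Notation "a <o> b" := (circ a b) (at level 40, left associativity) : ring_scope.

Definition trivial_brace (B : leftBraceType) : Prop :=
  forall a b : B, a <o> b = a + b.

Definition lam (B : leftBraceType) (a b : B) : B := - a + a <o> b.

Definition transitive_cycle_base (B : leftBraceType) (S : B -> Prop) : Prop :=
  (exists a : B, forall x : B, S x <-> exists g : B, x = lam g a) /\
  (forall H : B -> Prop,
     H 0 -> (forall x y, H x -> H y -> H (x - y)) ->
     (forall x, S x -> H x) -> forall x, H x).

Section BraceTheory.
Variable B : leftBraceType.
Implicit Types a b c x y z : B.

Lemma circx0 a : a <o> 0 = a.
Proof.
apply: (addrI (- a)); rewrite addNr.
have := circDr a 0 0; rewrite addr0 -addrA => h.
by apply: (addrI (a <o> 0)); rewrite -h addr0.
Qed.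

Lemma cone0 : cone = 0 :> B.
Proof. by rewrite -[RHS]circ1x circx0. Qed.

Lemma circ0x a : 0 <o> a = a.
Proof. by rewrite -cone0 circ1x. Qed.

Lemma circx1 : right_id cone (@circ B).
Proof. by move=> a; rewrite cone0 circx0. Qed.

Lemma cVx a : cinv a <o> a = 0.
Proof. by rewrite circVx cone0. Qed.

Lemma cxV a : a <o> cinv a = 0.
Proof.
rewrite -[LHS]circ0x -{1}(cVx (cinv a)) -circA [cinv a <o> _]circA cVx circ0x.
exact: cVx.
Qed.

Lemma circxV : right_inverse cone (@cinv B) (@circ B).
Proof. by move=> a; rewrite cone0 cxV. Qed.

Lemma cKx a : cancel (circ a) (circ (cinv a)).
Proof. by move=> b; rewrite circA cVx circ0x. Qed.

Lemma cVKx a : cancel (circ (cinv a)) (circ a).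
Proof. by move=> b; rewrite circA cxV circ0x. Qed.

Lemma circI a : injective (circ a).
Proof. exact: can_inj (cKx a). Qed.

Lemma cinvK : involutive (@cinv B).
Proof. by move=> a; apply: (@circI (cinv a)); rewrite cxV cVx. Qed.

Lemma circE a b : a <o> b = a + lam a b.
Proof. by rewrite /lam addrA subrr add0r. Qed.

Lemma lam_circ a b : lam a b = a <o> b - a.
Proof. by rewrite /lam addrC. Qed.

Lemma lamD a b c : lam a (b + c) = lam a b + lam a c.
Proof. by rewrite !lam_circ circDr addrA. Qed.

Lemma lam0 a : lam a 0 = 0.
Proof. by rewrite lam_circ circx0 subrr. Qed.

Lemma lamN a b : lam a (- b) = - lam a b.
Proof. by apply: (addrI (lam a b)); rewrite -lamD !subrr lam0. Qed.

Lemma lamM a b c : lam (a <o> b) c = lam a (lam b c).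
Proof.
rewrite [lam b c]/lam lamD lamN !lam_circ circA.
by rewrite opprB [RHS]addrC addrA subrK.
Qed.

Lemma lam0x b : lam 0 b = b.
Proof. by rewrite lam_circ circ0x subr0. Qed.

Lemma lamK a : cancel (lam a) (lam (cinv a)).
Proof. by move=> b; rewrite -lamM cVx lam0x. Qed.

Lemma addr_lam a c : a + c = a <o> lam (cinv a) c.
Proof. by rewrite circE -lamM cxV lam0x. Qed.

Lemma lamV a : lam (cinv a) a = - cinv a.
Proof. by rewrite /lam cVx addr0. Qed.

Lemma lamVN a : lam a (cinv a) = - a.
Proof. by rewrite /lam cxV addr0. Qed.

End BraceTheory.

(* The multiplicative group (B, <o>); it is a finGroupType when B is finite. *)
Definition mul_group (B : Type) : Type := B.

HB.instance Definition _ (B : leftBraceType) := Choice.copy (mul_group B) B.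
HB.instance Definition _ (B : leftBraceType) :=
  isGroup.Build (mul_group B) (@circA B) (@circ1x B) (@circx1 B)
    (@circVx B) (@circxV B).
HB.instance Definition _ (B : finLeftBraceType) :=
  Finite.copy (mul_group B) B.


Section BraceSolution.
Variables (B : leftBraceType) (a : B).
Implicit Types x y z : B.

Local Notation L x := (lam x a).

Definition brace_sigma x y : B := L x <o> y.
Definition brace_tau y x : B := cinv (L (brace_sigma x y)) <o> x.
Definition brace_r (t : B * B) : B * B :=
  (brace_sigma t.1 t.2, brace_tau t.2 t.1).

(* tau_y(x) = sigma_{sigma_x(y)}^{-1}(x) *)
Lemma brace_tauE x y : brace_sigma (brace_sigma x y) (brace_tau y x) = x.
Proof. exact: cVKx. Qed.

Lemma brace_sigma_bij x : bijective (brace_sigma x).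
Proof. by exists (circ (cinv (L x))); [exact: cKx | exact: cVKx]. Qed.

Let L_sigma x y : L x <o> L y = L x + L (brace_sigma x y).
Proof. by rewrite circE -lamM. Qed.

Let L_tau x y :
  L (brace_sigma x y) <o> L (brace_tau y x) = L x <o> L y.
Proof. by rewrite !L_sigma brace_tauE addrC. Qed.

Lemma brace_tau_bij y : bijective (brace_tau y).
Proof.
pose v z := cinv (L y <o> cinv (L z) - L y).
exists (fun z => brace_sigma (v z <o> y) z) => [x|z].
  suff -> : v (brace_tau y x) = L x by rewrite brace_tauE.
  rewrite /v -[RHS]cinvK; congr cinv; apply/eqP; rewrite subr_eq; apply/eqP.
  apply: (@circI _ (L x)); rewrite circA -L_tau -circA cxV -cone0 circx1.
  by rewrite circE lamD lamVN addrA subrr add0r -lamM.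
set u := v z <o> y; rewrite /brace_tau.
have Lu : L u = v z <o> (L y <o> cinv (L z)).
  have -> : L y <o> cinv (L z) = cinv (v z) + L y by rewrite cinvK subrK.
  by rewrite circE lamD lamVN addrA subrr add0r -lamM.
have Lx : L (brace_sigma u z) = v z.
  apply: (addrI (L u)); rewrite -L_sigma {1}Lu -!circA cVx circx0.
  by rewrite addrC circE -lamM.
have -> : brace_sigma (brace_sigma u z) y = u by rewrite /brace_sigma Lx.
exact: cKx.
Qed.

Lemma brace_r_involutive : involutive brace_r.
Proof.
case=> x y; rewrite /brace_r /= brace_tauE; congr pair.
by rewrite /brace_tau brace_tauE; exact: cKx.
Qed.

Lemma brace_r_ybe (t : B * B * B) :
  map12 brace_r (map23 brace_r (map12 brace_r t)) =
  map23 brace_r (map12 brace_r (map23 brace_r t)).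
Proof.
pose J (t : B * B * B) : B * B * B :=
  let: (x, y, z) := t in
  (x, brace_sigma x y, brace_sigma x (brace_sigma y z)).
pose s12 (t : B * B * B) : B * B * B := let: (x, y, z) := t in (y, x, z).
pose s23 (t : B * B * B) : B * B * B := let: (x, y, z) := t in (x, z, y).
have J_inj : injective J.
  by move=> [[x y] z] [[x' y'] z'] [<- /circI <- /circI /circI <-].
have J12 u : J (map12 brace_r u) = s12 (J u).
  case: u => [[x y] z]; rewrite /J /s12 /= brace_tauE; congr (_, _, _).
  by rewrite /brace_sigma !circA -[L x <o> L y]L_tau.
have J23 u : J (map23 brace_r u) = s23 (J u).
  by case: u => [[x y] z]; rewrite /J /s23 /= brace_tauE.
apply: J_inj; rewrite !(J12, J23).
by case: (J t) => [[x y] z].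
Qed.

Definition brace_solution : solution :=
  @Solution B brace_r (inhabits 0) brace_r_ybe brace_r_involutive
    brace_sigma_bij brace_tau_bij.

Lemma brace_solution_indecomposable (S : B -> Prop) :
  transitive_cycle_base S -> S a -> indecomposable brace_solution.
Proof.
move=> [[a0 S_orb] S_gen] Sa.
have orb z : S z -> exists g, z = L g.
  move=> /S_orb[h ->]; have [g ->] := (S_orb a).1 Sa.
  by exists (h <o> cinv g); rewrite lamM lamK.
pose H (c : B) := exists2 g, @perm_group brace_solution g & g =1 circ c.
have HL x : H (L x) by exists (@sigma brace_solution x) => //; constructor.
have HM c d : H c -> H d -> H (c <o> d).
  move=> [g Gg gE] [h Gh hE]; exists (g \o h); first exact: perm_group_comp.
  by move=> x; rewrite /= hE gE circA.
have HV c : H c -> H (cinv c).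
  move=> [g Gg gE]; exists (circ (cinv c)) => //.
  by apply: (perm_group_inv Gg) => x; rewrite gE ?cKx ?cVKx.
have HN w : H (- L w).
  set d := - L w; pose t := cinv d <o> w.
  have LtE : L t = cinv d by rewrite /t lamM -[L w]opprK -/d lamN lamV opprK.
  by rewrite -[d]cinvK -LtE; apply: HV.
have HB y x : H x -> H (x + y) /\ H (x - y).
  move: y x; apply: S_gen => [x|y z IHy IHz x Hx|y /orb[z ->] x Hx].
  - by rewrite subr0 addr0.
  - split; first by rewrite addrA; apply: (IHz _ _).2; apply: (IHy _ _).1.
    by rewrite opprB addrA; apply: (IHy _ _).2; apply: (IHz _ _).1.
  by rewrite !addr_lam lamN -lamM; split; apply: HM.
have Hall y : H y.
  rewrite -[y]add0r; apply: (HB y 0 _).1.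
  by exists id; [constructor | move=> x; rewrite circ0x].
move=> x y; have [g Gg gE] := Hall (y <o> cinv x).
by exists g => //; rewrite gE -circA cVx circx0.
Qed.

End BraceSolution.

(* The trivial left brace on an abelian group. *)
Definition triv_brace (V : Type) : Type := V.

Section TrivBrace.
Variable V : zmodType.

HB.instance Definition _ := GRing.Zmodule.copy (triv_brace V) V.

Fact triv_circDr (a b c : triv_brace V) : a + (b + c) = a + b - a + (a + c).
Proof. by rewrite [a + b]addrC addrK addrCA. Qed.

HB.instance Definition _ := isLeftBrace.Build (triv_brace V)
  (@addrA V) (@add0r V) (@addNr V) triv_circDr.

End TrivBrace.

HB.instance Definition _ (V : finZmodType) := Finite.copy (triv_brace V) V.

(* Homomorphisms (C, <o>) -> Aut(A, +). *)
Record add_action (C A : leftBraceType) := AddAction {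
  act :> C -> A -> A;
  actD : forall c, {morph act c : x y / x + y};
  act_bij : forall c, bijective (act c);
  actM : forall c d x, act (c <o> d) x = act c (act d x)
}.

(* As A is trivial, additive automorphisms of A are brace automorphisms. *)
Definition sdprod_brace (A C : leftBraceType) (trivA : trivial_brace A)
  (alpha : add_action C A) : Type := (A * C)%type.

Section SdprodBrace.
Variables (A C : leftBraceType) (trivA : trivial_brace A).
Variable alpha : add_action C A.
Local Notation P := (sdprod_brace trivA alpha).

HB.instance Definition _ := GRing.Zmodule.copy P (A * C)%type.

Definition sdprod_circ (x y : P) : P := (x.1 <o> alpha x.2 y.1, x.2 <o> y.2).
Definition sdprod_inv (x : P) : P :=
  (alpha (cinv x.2) (cinv x.1), cinv x.2).

Let act0 x : alpha 0 x = x.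
Proof.
have [g actK _] := act_bij alpha 0.
by apply: (can_inj actK); rewrite -actM circx0.
Qed.

Let actx0 c : alpha c 0 = 0.
Proof. by apply: (addrI (alpha c 0)); rewrite -actD !addr0. Qed.

Fact sdprod_circA : associative sdprod_circ.
Proof.
move=> x y z; rewrite /sdprod_circ /= circA; congr pair.
by rewrite !trivA actD actM addrA.
Qed.

Fact sdprod_circ1x : left_id (0 : P) sdprod_circ.
Proof. by case=> x y; rewrite /sdprod_circ /= act0 !circ0x. Qed.

Fact sdprod_circVx : left_inverse (0 : P) sdprod_inv sdprod_circ.
Proof.
move=> x; rewrite /sdprod_circ /= trivA -actD -trivA !cVx actx0.
by [].
Qed.

Fact sdprod_circDr (x y z : P) :
  sdprod_circ x (y + z) = sdprod_circ x y - x + sdprod_circ x z.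
Proof.
case: x y z => [x1 x2] [y1 y2] [z1 z2]; congr pair; last exact: circDr.
by rewrite /= actD circDr.
Qed.

HB.instance Definition _ := isLeftBrace.Build P
  sdprod_circA sdprod_circ1x sdprod_circVx sdprod_circDr.

End SdprodBrace.

HB.instance Definition _ (A C : finLeftBraceType) (trivA : trivial_brace A)
    (alpha : add_action C A) :=
  Finite.copy (sdprod_brace trivA alpha) (A * C)%type.

(* The group <a, b | a^p = b^(q^n) = 1, b^-1 a b = a^r> is finite, so being
   its largest finite factor is being isomorphic to it; a ^ b is b^-1 a b. *)
Definition type_c (p q n : nat) (gT : finGroupType) : Prop :=
  [/\ prime p, prime q, p != q &
   exists r : nat,
     [/\ (r != 1 %[mod p])%N, (r = 1 %[mod q])%N, (r ^ q = 1 %[mod p])%N &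
      ([set: gT] \isog
         Grp (a : b : (a ^+ p, b ^+ (q ^ n)%N, a ^ b = a ^+ r)))%g]].

(* Main.v *)
Require Import Defs.
From HB Require Import structures.
From mathcomp Require Import all_boot all_order all_algebra all_fingroup cyclic.
Import GRing.Theory.
Local Open Scope ring_scope.

Set Implicit Arguments.
Unset Strict Implicit.
Unset Printing Implicit Defensive.

(** In the semidirect product A ><| Z/q^n of trivial braces the lambda-action
   of x is (y1, y2) |-> (alpha_{x2} y1, y2), so the solution built from a has
     sigma_x y = (alpha_{x2} a1 + alpha_{a2} y1, a2 + y2).
   Since A has prime order p, each alpha_c is multiplication by a scalar. The
   presentation of the multiplicative group makes alpha nontrivial and kills
   its q-th power ([type_c_action]): hence alpha_c depends only on c mod q,
   and alpha_c = alpha_d exactly when c = d mod q. An element a of a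
   transitive cycle base has a1 <> 0 and a2 prime to q
   ([transitive_cycle_base_sdprod]), as otherwise its orbit lies in a proper
   additive subgroup.

   If a2 = b2 mod q, rescaling A by b1 / a1 and Z/q^n by b2 / a2 is an
   isomorphism: the second factor is 1 mod q, so it does not disturb alpha
   ([sdprod_iso_scale]).

   Conversely the scalar alpha_{a2} can be read off the solution
   ([sdprod_iso_act]). Two maps sigma_x and sigma_x' differ by a translation
   of the first coordinate, nontrivial for a suitable choice of x and x', and
   conjugating this translation by sigma_x raises it to the power alpha_{a2}.
   An isomorphism carries translations of this form to translations of the
   same form, and carries powers to powers, whence alpha_{a2} = alpha_{b2}. *)

(** * Groups of prime order and integers mod q^n *)

Lemma prime_zmod_cyclic (A : finZmodType) (e x : A) :
  prime #|A| -> e != 0 -> exists k, x = e *+ k.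
Proof.
move=> A_prime e_neq0.
have : [set: A] \subset <[e]>%g.
  by apply: prime_meetG; rewrite ?cardsT // setTI cycle_eq1.
move/subsetP/(_ x (in_setT x))/cycleP => [k ->].
by exists k; rewrite FinRing.zmodXgE.
Qed.

Lemma prime_zmod_eq_mulrn (A : finZmodType) (e : A) j k :
  prime #|A| -> e != 0 -> (e *+ j == e *+ k) = (j == k %[mod #|A|]).
Proof.
move=> A_prime e_neq0; rewrite -!FinRing.zmodXgE eq_expg_mod_order.
have := order_dvdG (in_setT e); rewrite cardsT => /(prime_nt_dvdP A_prime) -> //.
by rewrite order_eq1.
Qed.

(** This is how the scalar by which alpha_c acts on A becomes a number that can
   be transported between two solutions. *)
Lemma prime_zmod_endo (A : finZmodType) (f : A -> A) :
  prime #|A| -> {morph f : x y / x + y} -> exists k, forall x, f x = x *+ k.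
Proof.
move=> A_prime fD.
have f0 : f 0 = 0 by apply: (addrI (f 0)); rewrite -fD !addr0.
have fMn x k : f (x *+ k) = f x *+ k.
  by elim: k => [|k IHk]; rewrite ?mulr0n // !mulrS fD IHk.
have [e e_neq0] : exists e : A, e != 0.
  have : (1 < #|[set: A]|)%N by rewrite cardsT prime_gt1.
  by rewrite cardG_gt1 => /trivgPn[e _ ?]; exists e.
have [k fe] := prime_zmod_cyclic (f e) A_prime e_neq0; exists k => x.
by have [m ->] := prime_zmod_cyclic x A_prime e_neq0; rewrite fMn fe mulrnAC.
Qed.

(** An integer prime to q is a unit mod q^n, and the representative of d / c
   serves as multiplier. *)
Lemma Zq_generator (q n : nat) (c d : 'Z_(q ^ n)) :
  (0 < n)%N -> prime q -> ~~ (q %| c)%N -> exists m, d = c *+ m.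
Proof.
move=> n_gt0 q_prime qNc.
have Uc : c \is a GRing.unit.
  rewrite -[c]natr_Zp unitZpE ?coprimeXl ?prime_coprime //.
  by rewrite -(exp1n n) ltn_exp2r ?prime_gt1.
exists (c^-1 * d : 'Z_(q ^ n)).
by rewrite -mulr_natr natr_Zp mulrA divrr // mul1r.
Qed.

(** Reduction mod q factors through Z/q^n, as n > 0. *)
Lemma val_Zq_mod (q n m : nat) : (0 < n)%N -> prime q ->
  (nat_of_ord (m%:R : 'Z_(q ^ n))%R = m %[mod q])%N.
Proof.
move=> n_gt0 q_prime; rewrite val_Zp_nat.
  by rewrite modn_dvdm // dvdn_exp.
by rewrite -(exp1n n) ltn_exp2r ?prime_gt1.
Qed.

Lemma val_ZqD (q n : nat) (c d : 'Z_(q ^ n)) : (0 < n)%N -> prime q ->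
  (nat_of_ord (c + d)%R = c + d %[mod q])%N.
Proof.
by move=> n_gt0 q_prime; rewrite -[c]natr_Zp -[d]natr_Zp -natrD !val_Zq_mod
  // -[RHS]modnDm !val_Zq_mod // modnDm.
Qed.

Lemma eq_mod_Zq_sub (q n : nat) (c d : 'Z_(q ^ n)) : (0 < n)%N -> prime q ->
  (c == d %[mod q])%N = (q %| (c - d)%R)%N.
Proof.
move=> n_gt0 q_prime; rewrite -{1}[c](subrK d) val_ZqD //.
by rewrite -[X in _ == X %[mod _]]add0n eqn_modDr /dvdn mod0n.
Qed.

(** * Transitive cycle bases and isomorphisms of solutions *)

(** All elements of the orbit S are in the lambda-orbit of a, so a
   lambda-stable additive subgroup through a contains S, which generates B. *)
Lemma transitive_cycle_base_ind (B : leftBraceType) (S H : B -> Prop) (a : B) :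
    transitive_cycle_base S -> S a ->
    H 0 -> (forall x y, H x -> H y -> H (x - y)) ->
    (forall g x, H x -> H (lam g x)) -> H a ->
  forall x, H x.
Proof.
move=> [[s S_orb] S_gen] /S_orb[h ->] H0 HB Hlam Ha.
apply: S_gen => // x /S_orb[g ->]; apply: (Hlam).
by rewrite -(lamK h s); apply: Hlam.
Qed.

(** Compatibility with sigma suffices because tau is determined by sigma:
   tau_y x is the preimage of x under sigma_{sigma_x y}. *)
Lemma brace_isoP (B : leftBraceType) (a b : B) :
  isomorphic (brace_solution a) (brace_solution b) <->
  exists f : B -> B, bijective f /\
    forall x y, f (brace_sigma a x y) = brace_sigma b (f x) (f y).
Proof.
split=> -[f [f_bij f_iso]]; exists f; split=> // x y.
  by have [<-] := f_iso x y.
rewrite /= /brace_r /= f_iso; congr pair.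
apply: (@circI _ (lam (brace_sigma b (f x) (f y)) b)).
rewrite -!/(brace_sigma _ _ _) brace_tauE -f_iso.
by rewrite -f_iso brace_tauE.
Qed.

(** * Solutions on a semidirect product of trivial braces *)

Section Sdprod.
Variables (A : leftBraceType) (V : zmodType) (trivA : trivial_brace A).
Variable alpha : add_action (triv_brace V) A.
Local Notation P := (sdprod_brace trivA alpha).
Implicit Types (x y a b : P) (c d : V).

Lemma act_zero u : alpha 0 u = u.
Proof.
have [g actK _] := act_bij alpha 0.
by apply: (can_inj actK); rewrite -Defs.actM circ0x.
Qed.

Lemma act_addn c d u : alpha (c + d) u = alpha c (alpha d u).
Proof. by rewrite -Defs.actM. Qed.

Lemma act_mulrn c m u : alpha (c *+ m) u = iter m (alpha c) u.
Proof. by elim: m => [|m IHm]; rewrite ?act_zero // mulrS act_addn IHm. Qed.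

Lemma act_x0 c : alpha c 0 = 0.
Proof. by apply: (addrI (alpha c 0)); rewrite -actD !addr0. Qed.

Lemma actMn c u m : alpha c (u *+ m) = alpha c u *+ m.
Proof. by elim: m => [|m IHm]; rewrite ?act_x0 // !mulrS actD IHm. Qed.

Lemma sdprod_lam x y : lam x y = (alpha x.2 y.1, y.2) :> P.
Proof.
by congr pair; rewrite /= ?trivA addrA addNr add0r.
Qed.

Lemma sdprod_sigma a x y :
  brace_sigma a x y = (alpha x.2 a.1 + alpha a.2 y.1, a.2 + y.2) :> P.
Proof. by rewrite /brace_sigma sdprod_lam; congr pair; rewrite /= trivA. Qed.

Lemma sdprod_iso_scale (u : A -> A) (v : V -> V) a b :
    bijective u -> bijective v ->
    {morph u : s t / s + t} -> {morph v : c d / c + d} ->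
    (forall c s, u (alpha c s) = alpha c (u s)) ->
    (forall c, alpha (v c) =1 alpha c) ->
    u a.1 = b.1 -> v a.2 = b.2 ->
  isomorphic (brace_solution a) (brace_solution b).
Proof.
move=> [u' uK u'K] [v' vK v'K] uD vD uact actv ua va.
apply/brace_isoP; exists (fun x : P => (u x.1, v x.2) : P); split.
  exists (fun x : P => (u' x.1, v' x.2) : P) => -[s c] /=.
    by rewrite uK vK.
  by rewrite u'K v'K.
move=> x y; rewrite !sdprod_sigma /= uD vD !uact ua va.
by rewrite -va !actv.
Qed.

End Sdprod.

(** The action of a.2 is an invariant of the solution: it is the exponent to
   which conjugation by a map sigma_x raises the translations sigma_x' o
   sigma_x^-1 of the first coordinate. *)
Lemma sdprod_iso_act (A : finLeftBraceType) (V : zmodType)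
    (trivA : trivial_brace A) (alpha : add_action (triv_brace V) A)
    (a b : sdprod_brace trivA alpha) :
    prime #|A| -> a.1 != 0 -> (exists c s, alpha c s != s) ->
    isomorphic (brace_solution a) (brace_solution b) ->
  alpha a.2 =1 alpha b.2.
Proof.
move=> A_prime a1_neq0 [c [s act_c]] /brace_isoP[f [f_bij f_iso]].
set P := sdprod_brace trivA alpha in a b a1_neq0 f f_bij f_iso *.
have f_inj := bij_inj f_bij.
pose T (w : A) (y : P) : P := (w + y.1, y.2).
(* sigma_x1 is sigma_x0 followed by the translation T w. *)
pose x0 : P := 0; pose x1 : P := (0, c); pose w := alpha c a.1 - a.1.
have w_neq0 : w != 0.
  apply: contra act_c; rewrite subr_eq0 => /eqP act_a1.
  have [k ->] := prime_zmod_cyclic s A_prime a1_neq0.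
  by rewrite actMn act_a1.
pose w' := alpha (f x1).2 b.1 - alpha (f x0).2 b.1.
have fT z : f (T w z) = T w' (f z).
  have [g _ sK] := brace_sigma_bij a x0.
  rewrite -(sK z); set y := g z.
  have -> : T w (brace_sigma a x0 y) = brace_sigma a x1 y.
    by rewrite !sdprod_sigma /T /= act_zero addrA subrK.
  by rewrite !f_iso !sdprod_sigma /T /= addrA subrK.
have fTMn k z : f (T (w *+ k) z) = T (w' *+ k) (f z).
  elim: k => [|k IHk]; first by rewrite /T !mulr0n !add0r -!surjective_pairing.
  have TS v (y : P) : T (v *+ k.+1) y = T v (T (v *+ k) y).
    by rewrite /T /= mulrS addrA.
  by rewrite !TS fT IHk.
have w'_neq0 : w' != 0.
  apply: contra w_neq0 => /eqP w'0; have := fT 0.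
  rewrite w'0 /T add0r -surjective_pairing => /f_inj[].
  by rewrite addr0 => ->.
have [k act_a] := prime_zmod_endo A_prime (actD alpha a.2).
(* Both sides of sigma_x0 o T w = T (alpha a.2 w) o sigma_x0 are carried by f
   to the other solution, where w' must be scaled by the same k. *)
have act_b : alpha b.2 w' = w' *+ k.
  have : f (brace_sigma a x0 (T w 0)) =
         f (T (w *+ k) (brace_sigma a x0 0)).
    by rewrite !sdprod_sigma /T /= actD act_a addrCA.
  rewrite f_iso fT fTMn f_iso !sdprod_sigma /T /= => -[].
  by rewrite actD addrCA => /addIr.
move=> u; have [m ->] := prime_zmod_cyclic u A_prime w'_neq0.
by rewrite !actMn act_b act_a.
Qed.

(** * The action when the multiplicative group is of type c *)

Section TypeC.
Variables (n p q : nat) (n_gt0 : (0 < n)%N).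
Variables (A : finLeftBraceType) (trivA : trivial_brace A).
Variable alpha : add_action (triv_brace 'Z_(q ^ n)) A.
Local Notation P := (sdprod_brace trivA alpha).
Hypotheses (p_prime : prime p) (cardA : #|A| = p).

Lemma sdprod_mulg (x y : mul_group P) :
  (x * y)%g = (x.1 + alpha x.2 y.1, x.2 + y.2).
Proof. by congr pair; rewrite /= trivA. Qed.

Lemma expg_snd (x : mul_group P) k : (x ^+ k)%g.2 = x.2 *+ k.
Proof. by elim: k => [|k IHk] //; rewrite expgS mulrS -IHk. Qed.

Lemma expg_ker (x : mul_group P) k :
  x.2 = 0 -> (x ^+ k)%g = (x.1 *+ k, 0).
Proof.
move=> x0; elim: k => [|k IHk] //; rewrite expgS IHk mulrS sdprod_mulg /= x0.
by rewrite act_zero addr0.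
Qed.

(** With x, y the two generators of the presentation, x lies in A since its
   order divides p, which is prime to q^n. It is nontrivial, as y alone
   generates at most q^n elements, and y2 is prime to q, as x and y generate.
   The relation x ^ y = x ^+ r then says that alpha_{y2} is multiplication by
   1/r, where r <> 1 and r^q = 1 mod p; and y2 generates Z/q^n. *)
Lemma type_c_action : type_c p q n (mul_group P) ->
  (exists c u, alpha c u != u) /\ (forall c u, alpha (c *+ q) u = u).
Proof.
have A_prime : prime #|A| by rewrite cardA.
case=> _ q_prime p_neq_q [r [r_neq1 _ rq /isoGrp_hom/existsP[[x y] /= /eqP]]].
case=> gen_xy xp yqn xy.
have qn_gt1 : (1 < q ^ n)%N by rewrite -(exp1n n) ltn_exp2r ?prime_gt1.
have x2 : x.2 = 0.
  have pU : (p%:R : 'Z_(q ^ n)) \is a GRing.unit.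
    by rewrite unitZpE // coprimeXl // prime_coprime // dvdn_prime2 // eq_sym.
  apply: (mulIr pU); rewrite mul0r mulr_natr.
  by have := expg_snd x p; rewrite xp.
have y2 : ~~ (q %| (y.2 : 'Z_(q ^ n)))%N.
  apply/negP => q_y2.
  pose K := [set z : mul_group P | (q %| (z.2 : 'Z_(q ^ n)))%N].
  have gK : group_set K.
    apply/group_setP; split=> [|z t]; rewrite !inE ?dvdn0 // => z2 t2.
    by rewrite sdprod_mulg /dvdn /= val_ZqD // -/(dvdn q _) dvdn_add.
  have : ((0, 1) : mul_group P) \in [set: mul_group P] by rewrite inE.
  rewrite -gen_xy => /(subsetP (_ : _ \subset Group gK)).
  rewrite join_subG !cycle_subG !inE x2 dvdn0 q_y2 => /(_ isT).
  by rewrite /dvdn /= (val_Zq_mod 1 n_gt0 q_prime) modn_small // prime_gt1.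
have x1 : x.1 != 0.
  apply/eqP => x1; have x_1 : x = 1%g by rewrite [x]surjective_pairing x1 x2.
  move: gen_xy; rewrite x_1 cycle1 joing1G => gen_y.
  have : (#[y]%g %| q ^ n)%N by rewrite order_dvdn yqn.
  rewrite orderE gen_y cardsT card_prod cardA card_ord Zp_cast //.
  move/dvdn_leq; rewrite expn_gt0 prime_gt0 // => /(_ isT).
  by rewrite leqNgt -[X in (X < _)%N]mul1n ltn_pmul2r ?prime_gt1 // expn_gt0 prime_gt0.
have xE : x.1 = alpha y.2 x.1 *+ r.
  have := conjgC x y; rewrite xy expg_ker // !sdprod_mulg x2 act_zero => -[].
  by rewrite addrC => /addrI; rewrite actMn.
split.
  exists y.2, x.1; apply: contra r_neq1 => /eqP act_x.
  by rewrite -cardA -(prime_zmod_eq_mulrn _ _ _ x1) // -{1}act_x -xE.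
have act_yq u : alpha (y.2 *+ q) u = u.
  have iterE j : iter j (alpha y.2) x.1 *+ (r ^ j)%N = x.1.
    elim: j => [|j IHj] //.
    by rewrite expnS mulnC mulrnA /= -actMn IHj -xE.
  have rqE (z : A) : z *+ (r ^ q) = z.
    have [->|z_neq0] := eqVneq z 0; first by rewrite mul0rn.
    by apply/eqP; rewrite -{2}[z]mulr1n prime_zmod_eq_mulrn // cardA rq.
  have [k ->] := prime_zmod_cyclic u A_prime x1.
  by rewrite actMn act_mulrn -[iter _ _ _]rqE iterE.
move=> c u; have [m ->] := Zq_generator c n_gt0 q_prime y2.
rewrite mulrnAC act_mulrn; elim: m => //= m ->; exact: act_yq.
Qed.

(** The equations x.1 = 0 and q %| x.2 define proper additive subgroups, both
   stable under lambda. *)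
Lemma transitive_cycle_base_sdprod (S : P -> Prop) (a : P) :
    prime q -> transitive_cycle_base S -> S a ->
  a.1 != 0 /\ ~~ (q %| (a.2 : 'Z_(q ^ n)))%N.
Proof.
move=> q_prime tcbS Sa; split.
  apply/eqP => a1_eq0.
  have A0 (u : A) : u = 0.
    pose H (x : P) := x.1 = 0.
    apply: (@transitive_cycle_base_ind _ S H a _ _ _ _ _ _ (u, 0)) => //.
      by move=> x y; rewrite /H /= => -> ->; rewrite subr0.
    by move=> g x; rewrite /H sdprod_lam /= => ->; rewrite act_x0.
  have : (1 < #|A|)%N by rewrite cardA prime_gt1.
  by case/card_gt1P => u [v [_ _]]; rewrite (A0 u) (A0 v) eqxx.
apply/negP => q_a2; suff : (q %| (1%R : 'Z_(q ^ n)))%N.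
  by rewrite /dvdn /= (val_Zq_mod 1 n_gt0 q_prime) modn_small // prime_gt1.
pose H (x : P) := (q %| (x.2 : 'Z_(q ^ n)))%N.
apply: (@transitive_cycle_base_ind _ S H a _ _ _ _ _ _ (0, 1)) => //.
- by rewrite /H dvdn0.
- move=> x y /eqP x0 /eqP y0; rewrite /H -eq_mod_Zq_sub //.
  by rewrite x0 y0.
by move=> g x; rewrite /H sdprod_lam.
Qed.

Lemma act_mod (q_prime : prime q)
    (act_q : forall c u, alpha (c *+ q) u = u) (c d : 'Z_(q ^ n)) :
  (c = d %[mod q])%N -> alpha c =1 alpha d.
Proof.
move=> /eqP; rewrite eq_mod_Zq_sub // => /dvdnP[k cdE] u.
by rewrite -{1}[c](subrK d) act_addn -[c - d]natr_Zp cdE mulrnA act_q.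
Qed.

End TypeC.

(** * Classification of the solutions *)

Theorem corollary4p6 (n p q : nat) (n_gt0 : (0 < n)%N)
  (p_prime : prime p) (q_prime : prime q) (p_neq_q : p != q)
  (q_lt_p : (q < p)%N)
  (Ap : finLeftBraceType) (trivAp : trivial_brace Ap) (cardAp : #|Ap| = p)
  (alpha : add_action (triv_brace 'Z_(q ^ n)) Ap)
  (type_c_group : type_c p q n (mul_group (sdprod_brace trivAp alpha)))
  (S1 S2 : sdprod_brace trivAp alpha -> Prop)
  (tcbS1 : transitive_cycle_base S1) (tcbS2 : transitive_cycle_base S2)
  (a b : sdprod_brace trivAp alpha) (S1a : S1 a) (S2b : S2 b) :
  isomorphic (brace_solution a) (brace_solution b) <->
  ((a.2 : 'Z_(q ^ n)) = (b.2 : 'Z_(q ^ n)) %[mod q])%N.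
Proof.
have A_prime : prime #|Ap| by rewrite cardAp.
have [act_neq act_q] := type_c_action n_gt0 p_prime cardAp type_c_group.
have [a1 a2] := transitive_cycle_base_sdprod n_gt0 p_prime cardAp q_prime tcbS1 S1a.
have [b1 b2] := transitive_cycle_base_sdprod n_gt0 p_prime cardAp q_prime tcbS2 S2b.
split=> [iso_ab | ab].
  have act_ab := sdprod_iso_act A_prime a1 act_neq iso_ab.
  apply/eqP; rewrite eq_mod_Zq_sub //; apply: contraT => q_ndvd.
  have [c [u]] := act_neq; have [m ->] := Zq_generator c n_gt0 q_prime q_ndvd.
  suff act_sub v : alpha (a.2 - b.2) v = v.
    by rewrite act_mulrn; elim: m => [|m IHm] /=; rewrite ?act_sub // eqxx.
  have -> : v = alpha b.2 (alpha (- b.2) v) by rewrite -act_addn subrr act_zero.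
  by rewrite -act_addn subrK act_ab.
(* j and m represent b1 / a1 and b2 / a2, while k and l give the inverse
   scalings. *)
have [j b1E] := prime_zmod_cyclic b.1 A_prime a1.
have [m b2E] := Zq_generator b.2 n_gt0 q_prime a2.
have [k a1E] := prime_zmod_cyclic a.1 A_prime b1.
have [l a2E] := Zq_generator a.2 n_gt0 q_prime b2.
apply: (@sdprod_iso_scale _ _ _ _ (fun u => u *+ j) (fun c => c *+ m)) => //.
- exists (fun u => u *+ k) => u.
    have [i ->] := prime_zmod_cyclic u A_prime a1.
    by rewrite !(mulrnAC _ i) -b1E -a1E.
  have [i ->] := prime_zmod_cyclic u A_prime b1.
  by rewrite !(mulrnAC _ i) -a1E -b1E.
- exists (fun c => c *+ l) => c.
    have [i ->] := Zq_generator c n_gt0 q_prime a2.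
    by rewrite !(mulrnAC _ i) -b2E -a2E.
  have [i ->] := Zq_generator c n_gt0 q_prime b2.
  by rewrite !(mulrnAC _ i) -a2E -b2E.
- by move=> u v; rewrite mulrnDl.
- by move=> c d; rewrite mulrnDl.
- by move=> c u; rewrite actMn.
move=> c; have [i ->] := Zq_generator c n_gt0 q_prime a2 => u.
(* c = i a2 is sent to i b2, and a2 and b2 act alike. *)
rewrite mulrnAC -b2E !act_mulrn; apply: eq_iter.
by move=> v; rewrite (act_mod n_gt0 q_prime act_q ab).
Qed.
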